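(* Let $f:\mathbb{R}^n\to\mathbb{R}^n$, $x_0:\mathbb{R}^2\to\mathbb{R}^n$, and $g:\mathbb{R}^2\times\mathbb{R}^n\to\mathbb{R}$ be locally Lipschitz continuous and directionally differentiable. For some scalar $t_f>0$, let $x:[0,t_f]\times\mathbb{R}^2\to\mathbb{R}^n$ be such that, for each $p\in\mathbb{R}^2$, $x(\cdot,p)$ is the unique solution on $[0,t_f]$ of the ODE system $$\frac{dx}{dt}(t,p)=f(x(t,p)),\qquad x(0,p)=x_0(p).$$ Define $\phi:\mathbb{R}^2\to\mathbb{R}$ by $\phi(p):=g(p,x(t_f,p))$. Consider some particular $p\in\mathbb{R}^2$. For each $d\in\mathbb{R}^2$, let $y(\cdot,d)$ denote a solution on $[0,t_f]$ of the ODE $$\frac{dy}{dt}(t,d)=f'(x(t,p);y(t,d)),\qquad y(0,d)=x_0'(p;d).$$ Then, for each $d\in\mathbb{R}^2$, $y(\cdot,d)$ is in fact the unique solution of this ODE. Moreover, if for each $d\in\mathbb{R}^2$ we define $$\psi(d):=g'\big((p,x(t_f,p));(d,y(t_f,d))\big),$$ then $$\frac12\begin{bmatrix}\psi(1,0)-\psi(-1,0)\\ \psi(0,1)-\psi(0,-1)\end{bmatrix}$$ is an element of $\partial\phi(p)$.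
   Context: For a function $h$, $h'(x;d):=\lim_{t\downarrow 0}\frac{h(x+td)-h(x)}{t}$ denotes the one-sided directional derivative (taken componentwise for vector-valued functions); $h$ is directionally differentiable if $h'(x;d)$ exists (finite) for every domain point $x$ and every direction $d$. $\partial\phi(p)$ denotes Clarke's generalized gradient: for a locally Lipschitz continuous $\phi:\mathbb{R}^2\to\mathbb{R}$, $\phi^\circ(p;d):=\limsup_{q\to p,\ t\downarrow 0}\frac{\phi(q+td)-\phi(q)}{t}$ and $\partial\phi(p):=\{s\in\mathbb{R}^2:\phi^\circ(p;d)\ge\langle s,d\rangle\ \ \forall d\in\mathbb{R}^2\}$, where $\langle\cdot,\cdot\rangle$ is the Euclidean inner product. *)

(* Defs.v *)
From mathcomp Require Import all_boot all_order all_algebra.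
From mathcomp Require Import all_classical all_reals all_analysis.

Set Implicit Arguments.
Unset Strict Implicit.
Unset Printing Implicit Defensive.

Import Order.TTheory GRing.Theory Num.Theory.
Import numFieldNormedType.Exports.

Local Open Scope classical_set_scope.
Local Open Scope ring_scope.

Definition locally_lipschitz (R : realType) (V W : normedModType R)
    (h : V -> W) : Prop :=
  forall x : V, exists2 U : set V, nbhs x U & [lipschitz h z | z in U].

Definition dir_quotient (R : realType) (V W : normedModType R)
    (h : V -> W) (x d : V) (t : R) : W :=
  t^-1 *: (h (x + t *: d) - h x).

(* Meaningful only where the limit exists, cf. [dir_differentiable]; on
   'rV[R]_n, a limit is the same thing as a componentwise limit. *)
Definition dir_derive (R : realType) (V W : normedModType R)
    (h : V -> W) (x d : V) : W :=
  lim (dir_quotient h x d t @[t --> 0^'+]).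

Definition dir_differentiable (R : realType) (V W : normedModType R)
    (h : V -> W) : Prop :=
  forall x d : V, cvg (dir_quotient h x d t @[t --> 0^'+]).

Definition absolutely_continuous_on (R : realType) (V : normedModType R)
    (a b : R) (u : R -> V) : Prop :=
  forall eps : R, 0 < eps -> exists2 delta : R, 0 < delta &
    forall (m : nat) (l r : 'I_m -> R),
      (forall i, a <= l i /\ l i <= r i /\ r i <= b) ->
      trivIset setT (fun i => `]l i, r i[%classic) ->
      \sum_(i < m) (r i - l i) < delta ->
      \sum_(i < m) `|u (r i) - u (l i)| < eps.

(* Solution on [0, T], in the sense of Caratheodory, of
     du/dt (t) = F t (u t),  u 0 = u0.
   The right-hand side t, v |-> h'(x t; v) of a sensitivity equation may be
   discontinuous in t, so that an everywhere differentiable solution need not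
   exist; for a continuous F this is the classical notion of solution.  The
   values of u outside of [0, T] are irrelevant, since derivatives are only
   taken at points of ]0, T[. *)
Definition ode_solution (R : realType) (n : nat) (T : R)
    (F : R -> 'rV[R]_n -> 'rV[R]_n) (u0 : 'rV[R]_n) (u : R -> 'rV[R]_n) :
    Prop :=
  [/\ absolutely_continuous_on 0 T u,
      {ae (@lebesgue_measure R), forall t : R,
        t \in `]0, T[ -> is_derive t 1 u (F t (u t))}
    & u 0 = u0].

Definition unique_ode_solution (R : realType) (n : nat) (T : R)
    (F : R -> 'rV[R]_n -> 'rV[R]_n) (u0 : 'rV[R]_n) (u : R -> 'rV[R]_n) :
    Prop :=
  ode_solution T F u0 u /\
  forall v, ode_solution T F u0 v -> {in `[0, T], v =1 u}.

Definition vec2 (R : realType) (a b : R) : 'rV[R]_2 :=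
  \row_(i < 2) (if i == ord0 then a else b).

Definition inner (R : realType) (n : nat) (u v : 'rV[R]_n) : R :=
  \sum_(i < n) u ord0 i * v ord0 i.

(* Extended-real-valued; finite when phi is locally Lipschitz near p. *)
Definition clarke_dir_derive (R : realType) (phi : 'rV[R]_2 -> R)
    (p d : 'rV[R]_2) : \bar R :=
  limf_esup (fun qt : 'rV[R]_2 * R =>
      ((phi (qt.1 + qt.2 *: d) - phi qt.1) / qt.2)%:E)
    (filter_prod (nbhs p) (0^'+)).

Definition clarke_gradient (R : realType) (phi : 'rV[R]_2 -> R)
    (p : 'rV[R]_2) : set 'rV[R]_2 :=
  [set s | forall d : 'rV[R]_2, ((inner s d)%:E <= clarke_dir_derive phi p d)%E].

(* Main.v *)
(* The directional derivative of [q |-> x tf q] at [p] in the direction [d] is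
   [y tf d]: by Gronwall's lemma, the distance between the difference quotient
   of the solutions and [y] is controlled by the time integral of the error of
   the difference quotients of [f] along [x] and [y], which tends to zero by
   dominated convergence.  Composing with [g] makes [psi] the directional
   derivative of [phi] at [p].  In the plane, evaluating the difference quotient
   of [phi] in the direction [d = (d1, d2)] at the base points [p - t (d1, 0)]
   and [p - t (0, d2)] shows that the Clarke derivative is at least
   [psi (0, d2) - psi (-d1, 0)] and [psi (d1, 0) - psi (0, -d2)]; by positive
   homogeneity the mean of these two numbers is the inner product of [d] with
   the announced vector. *)

Require Import Defs.
From mathcomp Require Import all_boot all_order all_algebra.
From mathcomp Require Import all_classical all_reals all_analysis.
From mathcomp Require Import measurable_realfun ring lra.

Set Implicit Arguments.
Unset Strict Implicit.
Unset Printing Implicit Defensive.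

Import Order.TTheory GRing.Theory Num.Theory.
Import numFieldNormedType.Exports.

Local Open Scope classical_set_scope.
Local Open Scope ring_scope.

(** * Cousin partitions and monotonicity of absolutely continuous functions *)

Section absolutely_continuous_functions.
Context {R : realType}.
Implicit Types (V : normedModType R) (a b t T : R).
Local Notation mu := (@lebesgue_measure R).

(** Compactness of [[0, T]] for a point-dependent [delta]: the local hypothesis at the supremum of
    the [t] with [P 0 t] would carry [P] past that supremum if it were below [T]. *)
Lemma cousin T (P : R -> R -> Prop) : 0 <= T ->
  (forall a b c, 0 <= a -> a <= b -> b <= c -> c <= T ->
    P a b -> P b c -> P a c) ->
  (forall t, 0 <= t -> t <= T -> exists2 delta, 0 < delta &
    forall a b, 0 <= a -> a <= t -> t <= b -> b <= T -> b - a < delta ->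
      P a b) ->
  P 0 T.
Proof.
move=> T0 Padd Ploc.
pose A := [set t | [/\ 0 <= t, t <= T & P 0 t]].
have A0 : A 0.
  split => //; have [d d0 Pd] := Ploc 0 (lexx _) T0.
  by apply: Pd; rewrite ?subrr.
have ubA : ubound A T by move=> t [].
have supA : has_sup A by split; [exists 0 | exists T].
have s0 : 0 <= sup A by apply: sup_upper_bound.
have sT : sup A <= T by apply: ge_sup; [exists 0 | ].
have [d d0 Pd] := Ploc _ s0 sT.
have d20 : 0 < d / 2 by rewrite divr_gt0.
have [a [a0 aT Pa] sa] := sup_adherent d20 supA.
have as_ : a <= sup A by apply: sup_upper_bound.
pose b := Num.min T (sup A + d / 2).
have sb : sup A <= b by rewrite le_min sT lerDl ltW.
have bT : b <= T by rewrite ge_min lexx.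
have bs : b <= sup A + d / 2 by rewrite ge_min lexx orbT.
have Ab : A b.
  split => //; first exact: le_trans sb.
  apply: (Padd 0 a b) => //; first exact: le_trans sb.
  by apply: Pd => //; lra.
have bs' : b <= sup A by apply: sup_upper_bound.
have -> : T = b; last by case: Ab.
apply/eqP; rewrite eq_le bT andbT /b le_min lexx /=.
move: bs'; rewrite /b ge_min => /orP[|]; lra.
Qed.

(** Intervals are listed from left to right, with gaps allowed, so that neighbouring families merge
    by concatenation and disjointness follows from the order. *)
Fixpoint interval_chain a (s : seq (R * R)) b : Prop :=
  if s is J :: s' then [/\ a <= J.1, J.1 <= J.2 & interval_chain J.2 s' b]
  else a <= b.

Lemma interval_chain_cat a b c (s s' : seq (R * R)) :
  interval_chain a s b -> interval_chain b s' c ->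
  interval_chain a (s ++ s') c.
Proof.
elim: s a => [|J s IH] a /=; last first.
  by move=> [aJ J12 ch] ch'; split => //; exact: IH.
case: s' => [|J s'] /=; first exact: le_trans.
by move=> ab [bJ J12 ch]; split => //; exact: le_trans bJ.
Qed.

Lemma interval_chain_nth a b (s : seq (R * R)) : interval_chain a s b ->
  a <= b /\ forall i, (i < size s)%N ->
  [/\ a <= (nth (0, 0) s i).1, (nth (0, 0) s i).1 <= (nth (0, 0) s i).2,
      (nth (0, 0) s i).2 <= b &
      forall j, (i < j < size s)%N ->
        (nth (0, 0) s i).2 <= (nth (0, 0) s j).1].
Proof.
elim: s a => [|J s IH] a //= [aJ J12 /IH[J2b IHs]].
split; first by rewrite (le_trans aJ) ?(le_trans J12).
case=> [_|i /=].
  by split => //; case => // j /=; rewrite ltnS => /IHs[].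
rewrite ltnS => /IHs[J2i i12 ib ij]; split => //.
  by rewrite (le_trans aJ) ?(le_trans J12).
by case => // j; rewrite !ltnS => /ij.
Qed.

Lemma interval_chain_trivIset a b (s : seq (R * R)) : interval_chain a s b ->
  trivIset setT (fun i : 'I_(size s) =>
    `](nth (0, 0) s i).1, (nth (0, 0) s i).2[%classic).
Proof.
move=> /interval_chain_nth[_ ch]; apply/trivIsetP => i j _ _.
have key (k l : 'I_(size s)) : (k < l)%N ->
    `](nth (0, 0) s k).1, (nth (0, 0) s k).2[%classic `&`
    `](nth (0, 0) s l).1, (nth (0, 0) s l).2[%classic = set0.
  move=> kl; have [_ _ _ /(_ l)] := ch _ (ltn_ord k).
  rewrite kl ltn_ord => /(_ isT) h.
  apply/seteqP; split => // z [] /=; rewrite !in_itv /= => /andP[_ zk] /andP[lz _].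
  lra.
rewrite -val_eqE /= neq_ltn => /orP[/key//|/key].
by rewrite setIC.
Qed.

Lemma interval_chain_measure a b (s : seq (R * R)) (U : set R) :
  measurable U -> interval_chain a s b ->
  (forall i, (i < size s)%N ->
    `](nth (0, 0) s i).1, (nth (0, 0) s i).2[ `<=` U) ->
  ((\sum_(i < size s) ((nth (0, 0) s i).2 - (nth (0, 0) s i).1))%:E <= mu U)%E.
Proof.
move=> mU ch sU.
pose F (i : 'I_(size s)) : set R :=
  `](nth (0, 0) s i).1, (nth (0, 0) s i).2[%classic.
have mF i : measurable (F i) by exact: measurable_itv.
have mbF : measurable (\big[setU/set0]_(i < size s) F i).
  exact: bigsetU_measurable.
have := measure_semi_additive_ord mu mF (interval_chain_trivIset ch) mbF.
have -> : (\sum_(i < size s) mu (F i) = (\sum_(i < size s)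
    ((nth (0, 0) s i).2 - (nth (0, 0) s i).1))%:E)%E.
  rewrite -sumEFin; apply: eq_bigr => i _.
  rewrite /F lebesgue_measure_itv /= lte_fin; case: ltP => // h.
  have [_ ch'] := interval_chain_nth ch.
  have [_ h' _ _] := ch' _ (ltn_ord i).
  suff -> : (nth (0, 0) s i).1 = (nth (0, 0) s i).2 by rewrite subrr.
  by apply: le_anti; rewrite h h'.
move=> <-; apply: le_measure; rewrite ?inE //.
by elim/big_ind: _ => [//|A B AU BU z [/AU|/BU]//|i _]; exact: sU.
Qed.

(* The upper straddle derivative of [w] at [t] is at most [c]; unlike a genuine
   derivative, this makes sense for norms of differentiable curves. *)
Definition slope_le T (w : R -> R) t c :=
  forall eps, 0 < eps -> exists2 delta, 0 < delta &
    forall a b, 0 <= a -> a <= t -> t <= b -> b <= T -> b - a < delta ->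
      w b - w a <= (c + eps) * (b - a).

(* The exceptional points are covered by an open set [U] of small measure; a
   Cousin partition splits [0, T] into intervals with small slope and disjoint
   intervals contained in [U], and absolute continuity bounds the variation of
   [w] over the latter. *)
Lemma absolutely_continuous_nonincreasing T (w : R -> R) : 0 <= T ->
  absolutely_continuous_on 0 T w ->
  {ae mu, forall t, t \in `]0, T[ -> slope_le T w t 0} ->
  w T <= w 0.
Proof.
move=> T0 acw [A [mA A0 badA]].
suff H e : 0 < e -> w T - w 0 <= e * T + e.
  rewrite -subr_le0; apply/ler_addgt0Pr => e e0; rewrite add0r.
  have T1 : 0 < T + 1 by lra.
  have := H (e / (T + 1)) (divr_gt0 e0 T1).
  suff -> : e / (T + 1) * T + e / (T + 1) = e by [].
  by field; rewrite gt_eqF.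
move=> e0; have [d d0 acd] := acw _ e0.
(* The end points join the exceptional set because the hypothesis only concerns interior times. *)
pose D := A `|` [set 0; T].
have m1 t : measurable ([set t] : set R) by exact: measurable_set1.
have m2 : measurable ([set 0; T] : set R) by exact: measurableU.
have mD : measurable D by exact: measurableU.
have D0 : mu D = 0%E.
  apply: null_set_setU => //.
  by apply: null_set_setU => //; exact: lebesgue_measure_set1.
have D_fin : (mu D < +oo)%E by rewrite D0.
have [U [oU DU muU]] := lebesgue_regularity_outer mD D_fin d0.
have mU : measurable U by exact: open_measurable.
have {}muU : (mu U < d%:E)%E.
  rewrite -(setDUK DU); apply: le_lt_trans muU.
  have : (mu (D `|` U `\` D) <= mu D + mu (U `\` D))%E.
    by apply: measureU2 => //; exact: measurableD.
  by rewrite D0 add0e.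
(* The increment over [[a, b]] is charged to the slope [e] plus the variation over a chain inside
   [U]; this property is additive over adjacent intervals. *)
pose P a b := exists s, [/\ interval_chain a s b,
  forall i, (i < size s)%N ->
    `](nth (0, 0) s i).1, (nth (0, 0) s i).2[ `<=` U &
  w b - w a <= e * (b - a) + \sum_(J <- s) `|w J.2 - w J.1|].
have [s [ch sU ws]] : P 0 T.
  apply: cousin => //.
    move=> a b c _ _ _ _ [s [ch sU ws]] [s' [ch' sU' ws']].
    exists (s ++ s'); split; first exact: interval_chain_cat ch'.
      move=> i; rewrite size_cat nth_cat => h'.
      case: (ltnP i (size s)) => h; first exact: sU.
      by apply: sU'; rewrite ltn_subLR.
    rewrite big_cat /=; lra.
  (* Near a point of [U] the whole interval forms the chain; elsewhere the slope condition applies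
     and the chain is empty. *)
  move=> t t0 tT; case: (pselect (U t)) => Ut.
    have /nbhs_ballP[d' /= d'0 bU] : nbhs t U by exact: open_nbhs_nbhs.
    exists d' => // a b a0 at_ tb bT bad; exists [:: (a, b)]; split => //=.
    - by split => //; exact: le_trans tb.
    - case => //= _ z /=; rewrite in_itv /= => /andP[az zb].
      by apply: bU; rewrite /ball /= ltr_norml; apply/andP; split; lra.
    - rewrite big_seq1 /=; apply: (le_trans (ler_norm _)).
      by rewrite lerDr; apply: mulr_ge0; lra.
  have tT' : t \in `]0, T[.
    rewrite in_itv /= !lt_neqAle t0 tT !andbT; apply/andP; split.
      by apply/eqP => t0'; apply: Ut; apply: DU; right; left.
    by apply/eqP => tT'; apply: Ut; apply: DU; right; right.
  have good : slope_le T w t 0.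
    apply: contrapT => bad; apply: Ut; apply: DU; left; apply: badA => /=.
    by move=> h; apply: bad; exact: h.
  have [d' d'0 wd] := good _ e0; exists d' => // a b a0 at_ tb bT bad.
  exists [::]; split => //=; first exact: le_trans tb.
  by rewrite big_nil addr0; have := wd _ _ a0 at_ tb bT bad; rewrite add0r.
have [_ chn] := interval_chain_nth ch.
have := acd (size s) (fun i => (nth (0, 0) s i).1)
                     (fun i => (nth (0, 0) s i).2).
have -> : \sum_(i < size s)
    `|w (nth (0, 0) s i).2 - w (nth (0, 0) s i).1| =
    \sum_(J <- s) `|w J.2 - w J.1| by rewrite (big_nth (0, 0)) big_mkord.
move=> /(_ _ _ _)/ltW H.
apply: (le_trans ws); rewrite subr0 lerD2l; apply: H.
- by move=> i; have [] := chn _ (ltn_ord i).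
- exact: interval_chain_trivIset ch.
- by rewrite -lte_fin; apply: le_lt_trans muU; apply: interval_chain_measure ch sU.
Qed.

End absolutely_continuous_functions.

(** * Absolute continuity, straddle estimates and Gronwall's lemma *)

Section absolute_continuity_and_gronwall.
Context {R : realType}.
Implicit Types (V : normedModType R) (a b c k l r t T L : R).
Local Notation mu := (@lebesgue_measure R).

Lemma absolutely_continuous_on_id a b :
  absolutely_continuous_on a b (fun t : R => t : R^o).
Proof.
move=> e e0; exists e => // m l r lr _; apply: le_lt_trans.
by apply: ler_sum => i _; rewrite ger0_norm // subr_ge0; have [_ []] := lr i.
Qed.

Lemma absolutely_continuous_onS a b b' V (u : R -> V) : b' <= b ->
  absolutely_continuous_on a b u -> absolutely_continuous_on a b' u.
Proof.
move=> bb' acu e /acu[d d0 acd]; exists d => // m l r lr; apply: acd => i.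
by have [? [? rb]] := lr i; do !split => //; exact: le_trans bb'.
Qed.

(** Transfers absolute continuity to products, differences, norms and minima: each use only needs an
    estimate of increments. *)
Lemma absolutely_continuous_on_le a b V V' V'' C
    (u : R -> V) (v : R -> V') (w : R -> V'') : 0 <= C ->
  absolutely_continuous_on a b u -> absolutely_continuous_on a b v ->
  (forall l r, a <= l -> l <= r -> r <= b ->
    `|w r - w l| <= C * (`|u r - u l| + `|v r - v l|)) ->
  absolutely_continuous_on a b w.
Proof.
move=> C0 acu acv wuv e e0.
(* [C + 1] keeps the divisor positive, and the factor 2 shares [e] between [u] and [v]. *)
have C1 : 0 < 2 * (C + 1) by lra.
have e1 : 0 < e / (2 * (C + 1)) by rewrite divr_gt0.
have [d d0 acd] := acu _ e1; have [d' d'0 acd'] := acv _ e1.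
exists (Num.min d d'); first by rewrite lt_min d0.
move=> m l r lr tl; rewrite lt_min => /andP[/(acd _ _ _ lr tl) ud].
move=> /(acd' _ _ _ lr tl) vd.
apply: (@le_lt_trans _ _ (C * (\sum_(i < m) `|u (r i) - u (l i)| +
                     \sum_(i < m) `|v (r i) - v (l i)|))).
  rewrite -big_split mulr_sumr /=; apply: ler_sum => i _.
  by have [? [? ?]] := lr i; exact: wuv.
set S := _ + _.
have S0 : 0 <= S by rewrite addr_ge0 ?sumr_ge0.
have SE : S < e / (C + 1).
  have -> : e / (C + 1) = e / (2 * (C + 1)) + e / (2 * (C + 1)).
    by field; rewrite gt_eqF //; lra.
  exact: ltrD.
apply: (@le_lt_trans _ _ ((C + 1) * S)); first by apply: ler_wpM2r => //; lra.
by rewrite mulrC -ltr_pdivlMr //; lra.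
Qed.

Lemma absolutely_continuous_on_unif a b V (u : R -> V) :
  absolutely_continuous_on a b u ->
  forall eps, 0 < eps -> exists2 delta, 0 < delta & forall l r,
    a <= l -> l <= r -> r <= b -> r - l < delta -> `|u r - u l| < eps.
Proof.
move=> acu e /acu[d d0 acd]; exists d => // l r al lr rb rl.
have := acd 1%N (fun=> l) (fun=> r).
rewrite !big_ord1; apply => //.
by apply/trivIsetP => i j _ _; rewrite !ord1 eqxx.
Qed.

Lemma absolutely_continuous_on_bounded T V (u : R -> V) : 0 <= T ->
  absolutely_continuous_on 0 T u ->
  exists M, forall t, 0 <= t -> t <= T -> `|u t| <= M.
Proof.
move=> T0 acu.
apply: (@cousin _ T (fun a b => exists M, forall t, a <= t -> t <= b -> `|u t| <= M)) => //.
  move=> a b c _ ab bc _ [M MP] [N NP]; exists (Num.max M N) => t at_ tc.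
  rewrite le_max; case: (leP t b) => tb; first by rewrite MP.
  by rewrite NP ?orbT // ltW.
move=> t t0 tT; have [d d0 ud] := absolutely_continuous_on_unif acu ltr01.
exists d => // a b a0 at_ tb bT ba; exists (`|u t| + 1) => s as_ sb.
have : `|u s - u t| <= 1.
  case: (leP s t) => st; [rewrite distrC|]; apply: ltW; apply: ud => //; lra.
have := ler_normD (u s - u t) (u t); rewrite subrK; lra.
Qed.

Lemma is_derive_straddle V (u : R -> V) (c : V) t : is_derive t 1 u c ->
  forall eps, 0 < eps -> exists2 delta, 0 < delta &
    forall a b, a <= t -> t <= b -> b - a < delta ->
      `|u b - u a - (b - a) *: c| <= eps * (b - a).
Proof.
move=> [du <-] e e0.
have /cvgrPdist_lt/(_ _ e0) : h^-1 *: ((u \o shift t) (h *: 1) - u t)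
    @[h --> 0^'] --> 'D_1 u t by [].
move=> /nbhs_ballP[d /= d0 dP]; exists d => // a b at_ tb ba.
have key h : `|h| < d -> `|u (t + h) - u t - h *: 'D_1 u t| <= e * `|h|.
  have [->|h0] := eqVneq h 0; first by rewrite addr0 scale0r !subrr !normr0 mulr0.
  move=> hd; have : `|'D_1 u t - h^-1 *: ((u \o shift t) (h *: 1) - u t)| < e.
    by apply: dP => //; rewrite -ball_normE /= sub0r normrN.
  have -> : (u \o shift t) (h *: 1) = u (t + h) by rewrite /= addrC [h *: 1]mulr1.
  have -> : u (t + h) - u t - h *: 'D_1 u t =
      - (h *: ('D_1 u t - h^-1 *: (u (t + h) - u t))).
    by rewrite scalerBr scalerA divff // scale1r opprB.
  by rewrite normrN normrZ mulrC => /ltW; apply: ler_wpM2r.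
have hb := key (b - t); have ha := key (a - t).
rewrite !(addrC t) !subrK in ha hb.
(* Since [t] lies between [a] and [b], splitting there yields errors [e * (b - t)] and [e * (t - a)]
   that add up exactly. *)
have -> : u b - u a - (b - a) *: 'D_1 u t =
   (u b - u t - (b - t) *: 'D_1 u t) - (u a - u t - (a - t) *: 'D_1 u t).
  have -> : b - a = (b - t) - (a - t) by ring.
  rewrite scalerBl opprB [- (_ - _ - _)]opprD opprK [RHS]addrACA opprB.
  by rewrite subrKA [- _ + _]addrC.
apply: (le_trans (ler_normB _ _)).
have -> : e * (b - a) = e * `|b - t| + e * `|a - t|.
  by rewrite ger0_norm ?subr_ge0 // ler0_norm ?subr_le0 //; ring.
by apply: lerD; [apply: hb|apply: ha]; rewrite ltr_norml; apply/andP; split; lra.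
Qed.

Lemma slope_leS T T' (w : R -> R) t c : T' <= T ->
  slope_le T w t c -> slope_le T' w t c.
Proof.
move=> TT' wt e /wt[d d0 dP]; exists d => // a b a0 at_ tb bT.
by apply: dP => //; exact: le_trans TT'.
Qed.

Lemma slope_le_trans T (w : R -> R) t c c' : c <= c' ->
  slope_le T w t c -> slope_le T w t c'.
Proof.
move=> cc' wt e /wt[d d0 dP]; exists d => // a b a0 at_ tb bT ba.
by apply: (le_trans (dP _ _ a0 at_ tb bT ba)); apply: ler_wpM2r; lra.
Qed.

Lemma slope_le_norm T V (u : R -> V) (c : V) t : is_derive t 1 u c ->
  slope_le T (fun s => `|u s|) t `|c|.
Proof.
move=> /is_derive_straddle h e /h[d d0 dP]; exists d => // a b _ at_ tb _ ba.
have h1 := dP _ _ at_ tb ba.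
have h2 := lerB_dist (u b) (u a).
have h3 := ler_normD (u b - u a - (b - a) *: c) ((b - a) *: c).
rewrite subrK normrZ ger0_norm in h3; lra.
Qed.

Lemma expRN_lip L l r : 0 <= L -> 0 <= l -> l <= r ->
  `|expR (- (L * r)) - expR (- (L * l))| <= L * (r - l).
Proof.
move=> L0 l0 lr.
have -> : - (L * r) = - (L * l) + - (L * (r - l)) by ring.
rewrite expRD.
have Ll : 0 <= L * l by rewrite mulr_ge0.
have Lrl : 0 <= L * (r - l) by rewrite mulr_ge0 // subr_ge0.
have := expR_ge1Dx (- (L * (r - l))).
have : expR (- (L * (r - l))) <= 1 by rewrite -expR0 ler_expR oppr_le0.
have : expR (- (L * l)) <= 1 by rewrite -expR0 ler_expR oppr_le0.
have := expR_gt0 (- (L * l)).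
set p := expR _; set q := expR _ => p0 p1 q1 q2.
have -> : p * q - p = - (p * (1 - q)) by ring.
rewrite normrN ger0_norm; last by apply: mulr_ge0; lra.
apply: (@le_trans _ _ (1 * (1 - q))); last by lra.
by apply: ler_wpM2r; lra.
Qed.

(* [E] plays the part of a primitive of the inhomogeneous term [k]. *)
Lemma gronwall T L (w E : R -> R) : 0 <= L ->
  (forall t, 0 <= t -> t <= T -> 0 <= w t) ->
  absolutely_continuous_on 0 T w -> absolutely_continuous_on 0 T E ->
  {ae mu, forall t, t \in `]0, T[ -> exists k, [/\ 0 <= k,
     slope_le T w t (L * w t + k) & slope_le T (\- E) t (- k)]} ->
  forall t, 0 <= t -> t <= T -> w t <= expR (L * T) * (w 0 + (E t - E 0)).
Proof.
move=> L0 w0 acw acE slope t t0 tT.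
have T0 := le_trans t0 tT.
(* Integrating factor: [v] has slope at most zero almost everywhere, and comparing [v t] with [v 0]
   gives the bound. *)
pose v s := expR (- (L * s)) * w s - E s.
have [M wM] := absolutely_continuous_on_bounded T0 acw.
have M0 : 0 <= M by apply: le_trans (wM 0 _ T0).
pose z s : R := expR (- (L * s)) * w s.
have exp1 s : 0 <= s -> expR (- (L * s)) <= 1.
  by move=> s0; rewrite -expR0 ler_expR oppr_le0 mulr_ge0.
have acz : absolutely_continuous_on 0 T z.
  apply: (@absolutely_continuous_on_le _ _ _ _ _ (1 + M * L) _ _ _ _ acw
            (@absolutely_continuous_on_id 0 T)).
    by apply: addr_ge0 => //; apply: mulr_ge0.
  move=> l r l0 lr rT.
  have -> : z r - z l = expR (- (L * r)) * (w r - w l) +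
     w l * (expR (- (L * r)) - expR (- (L * l))) by rewrite /z; ring.
  apply: (le_trans (ler_normD _ _)); rewrite !normrM.
  have h1 : `|expR (- (L * r))| * `|w r - w l| <= 1 * `|w r - w l|.
    apply: ler_wpM2r => //; rewrite ger0_norm ?expR_ge0 // exp1 //.
    exact: le_trans lr.
  have h2 : `|w l| * `|expR (- (L * r)) - expR (- (L * l))| <= M * (L * (r - l)).
    by apply: ler_pM => //; [apply: wM => //; exact: le_trans rT|exact: expRN_lip].
  have h3 : `|(r : R^o) - l| = r - l by rewrite ger0_norm // subr_ge0.
  rewrite [`|(r : R^o) - l|]h3.
  have h4 : 0 <= (M * L) * `|w r - w l| by rewrite !mulr_ge0.
  have h5 : 0 <= r - l by rewrite subr_ge0.
  rewrite mulrDr !mulrDl; lra.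
have acv : absolutely_continuous_on 0 T v.
  apply: (@absolutely_continuous_on_le _ _ _ _ _ 1 _ _ _ _ acz acE) => // l r _ _ _.
  rewrite mul1r; have -> : v r - v l = (z r - z l) - (E r - E l).
    by rewrite /v /z; ring.
  exact: ler_normB.
have : v t <= v 0.
  apply: absolutely_continuous_nonincreasing => //.
    exact: absolutely_continuous_onS acv.
  move: slope; apply: filterS; first exact: (ae_filter_ringOfSetsType mu).
  move=> s hs st.
  have sT : s \in `]0, T[.
    by move: st; rewrite !in_itv /= => /andP[-> /lt_le_trans]; exact.
  have [k [k0 ws Es]] := hs sT.
  apply: (slope_leS tT) => e e0.
  have e4 : 0 < e / 4 by rewrite divr_gt0.
  have L1 : 0 < L + 1 by lra.
  have [d1 d10 wd] := ws _ e4; have [d2 d20 Ed] := Es _ e4.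
  (* The slope bound involves [w s], while the decay of the exponential acts on [w a]; continuity of
     [w] makes [L * (w s - w a)] at most [e / 4]. *)
  have [d3 d30 cd] := absolutely_continuous_on_unif acw (divr_gt0 e4 L1).
  exists (Num.min d1 (Num.min d2 d3)); first by rewrite !lt_min d10 d20.
  move=> a b a0 as_ sb bT; rewrite !lt_min => /and3P[ba1 ba2 ba3].
  have hw := wd _ _ a0 as_ sb bT ba1; have hE := Ed _ _ a0 as_ sb bT ba2.
  have wsa : L * (w s - w a) <= e / 4.
    have : `|w s - w a| < e / 4 / (L + 1) by apply: cd => //; lra.
    rewrite ltr_pdivlMr // => h.
    have h' := ler_norm (w s - w a).
    have h'' : L * (w s - w a) <= L * `|w s - w a| by apply: ler_wpM2l.
    have : 0 <= `|w s - w a| by [].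
    by rewrite mulrC mulrDl in h; lra.
  have b0 : 0 <= b by lra.
  have ab0 : 0 <= b - a by lra.
  have wa0 : 0 <= w a by apply: w0 => //; lra.
  have := exp1 b b0; have := expR_gt0 (- (L * b)).
  (* By [1 + u <= expR u], the integrating factor decreases fast enough from [a] to [b] to absorb
     the growth term [L * w a]. *)
  have hexp : expR (- (L * b)) * (L * (b - a)) <=
      expR (- (L * a)) - expR (- (L * b)).
    have -> : expR (- (L * a)) = expR (- (L * b)) * expR (L * (b - a)).
      by rewrite -expRD; congr expR; ring.
    have := expR_ge1Dx (L * (b - a)).
    have := expR_gt0 (- (L * b)).
    set p := expR (- _); set q := expR _ => p0 q1.
    have -> : p * q - p = p * (q - 1) by ring.
    by apply: ler_wpM2l; lra.
  rewrite /v; move: hexp; set p := expR (- (L * b)); set q := expR (- (L * a)).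
  move=> hexp p0 p1.
  have h1 := ler_wpM2l wa0 hexp.
  have h2 : p * (w b - w a) <= p * ((L * w s + k + e / 4) * (b - a)).
    by apply: ler_wpM2l => //; exact: ltW.
  have h3 : p * (b - a) * (L * (w s - w a) + k + e / 4) <=
            p * (b - a) * (k + e / 2).
    by apply: ler_wpM2l; [apply: mulr_ge0 => //; exact: ltW | lra].
  have h4 : p * ((b - a) * (k + e / 2)) <= 1 * ((b - a) * (k + e / 2)).
    by apply: ler_wpM2r => //; apply: mulr_ge0 => //; lra.
  have h5 : 0 <= e / 4 * (b - a) by apply: mulr_ge0 => //; exact: ltW.
  rewrite add0r; rewrite /= in hE.
  lra.
rewrite /v mulr0 oppr0 expR0 mul1r => h.
have h1 : expR (- (L * t)) * w t <= w 0 + (E t - E 0) by lra.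
have e0 : 0 < expR (L * T) by exact: expR_gt0.
rewrite -ler_pdivrMl // -expRN; apply: le_trans h1.
apply: ler_wpM2r; first exact: w0.
by rewrite ler_expR lerN2; apply: ler_wpM2l.
Qed.

End absolute_continuity_and_gronwall.

(** * Primitives of bounded measurable functions *)

Section primitives.
Context {R : realType}.
Implicit Types (k : R -> R) (C T : R).
Local Notation mu := (@lebesgue_measure R).

Lemma bounded_compact_integrable k C (K : set R) : compact K ->
  measurable_fun setT k -> (forall t, 0 <= k t <= C) ->
  mu.-integrable K (EFin \o k).
Proof.
move=> cK mk kC; apply: measurable_bounded_integrable.
- exact: compact_measurable.
- exact: compact_finite_measure.
- exact: measurable_funTS.
- exists C; split; first exact: num_real.
  move=> M CM t _ /=; have /andP[k0 ktC] := kC t.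
  by rewrite ger0_norm // (le_trans ktC) // ltW.
Qed.

Lemma bounded_locally_integrable k C :
  measurable_fun setT k -> (forall t, 0 <= k t <= C) ->
  locally_integrable setT k.
Proof.
move=> mk kC; split => //; first exact: openT.
by move=> K _ cK; have /integrableP[] := bounded_compact_integrable cK mk kC.
Qed.

Lemma primitive_absolutely_continuous k C T :
  measurable_fun setT k -> (forall t, 0 <= k t <= C) ->
  absolutely_continuous_on 0 T (fun t => \int[mu]_(s in `[0, t]) k s).
Proof.
move=> mk kC; have C0 : 0 <= C by have /andP[] := kC 0; exact: le_trans.
(* The bound on the integrand makes the primitive [C]-Lipschitz, so its increments are compared with
   those of the identity. *)
apply: (@absolutely_continuous_on_le _ _ _ _ _ _ C _ _ _ C0
          (absolutely_continuous_on_id 0 T) (absolutely_continuous_on_id 0 T)).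
move=> l r l0 lr rT.
have int a b : mu.-integrable `[a, b] (EFin \o k).
  by apply: bounded_compact_integrable mk kC; exact: segment_compact.
have sub : `]l, r] `<=` `[l, r].
  by move=> z /=; rewrite !in_itv /= => /andP[/ltW -> ->].
have int' : mu.-integrable `]l, r] (EFin \o k) by apply: integrableS (int l r).
have intC : mu.-integrable `]l, r] (EFin \o cst C).
  have cK : compact `[l, r]%classic by exact: segment_compact.
  apply: integrableS (bounded_compact_integrable (C := C) cK _ _) => //.
  by move=> t; rewrite C0 lexx.
rewrite Rintegral_itvB //.
rewrite ger0_norm; last by apply: Rintegral_ge0 => t _; have /andP[] := kC t.
apply: (@le_trans _ _ (\int[mu]_(_ in `]l, r]) C)).
  apply: le_Rintegral => //.
  by move=> t _; have /andP[] := kC t.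
rewrite Rintegral_cst //; apply: ler_wpM2l => //.
have : fine (mu `]l, r]) = r - l.
  by rewrite lebesgue_measure_itv /= lte_fin; case: ltP => /= rl; lra.
rewrite /= => ->; have h : `|(r : R^o) - l| = r - l by rewrite ger0_norm // subr_ge0.
rewrite [`|(r : R^o) - l|]h; lra.
Qed.

(** Supplies the [E] of [gronwall]: by Lebesgue differentiation, the primitive has derivative [k t]
    at almost every [t]. *)
Lemma primitive_slope k C T :
  measurable_fun setT k -> (forall t, 0 <= k t <= C) ->
  {ae mu, forall t, t \in `]0, T[ ->
    slope_le T (\- (fun t => \int[mu]_(s in `[0, t]) k s)) t (- k t)}.
Proof.
move=> mk kC.
have int y : mu.-integrable [set` Interval (BLeft 0) (BRight y)] (EFin \o k).
  by apply: bounded_compact_integrable mk kC; exact: segment_compact.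
have := FTC1 int (bounded_locally_integrable mk kC).
apply: filterS; first exact: (ae_filter_ringOfSetsType mu).
move=> t /= h; rewrite in_itv /= => /andP[t0 _].
have [|dE Et] := h; first by rewrite lte_fin.
set E := fun _ => _ in dE Et *.
have dEt : is_derive t 1 E (k t) by split; [exact: dE|rewrite -Et derive1E].
move=> e /(is_derive_straddle dEt)[d d0 dP]; exists d => // a b _ at_ tb _ ba /=.
have := dP _ _ at_ tb ba; rewrite ler_norml => /andP[+ _].
have -> : (b - a) *: k t = (b - a) * k t by [].
rewrite mulrDl; lra.
Qed.

End primitives.

(** * Lipschitz bounds near points and along curves *)

Section lipschitz_neighborhoods.
Context {R : realType}.
Implicit Types (V W : normedModType R).

Lemma locally_lipschitz_ball V W (h : V -> W) x : locally_lipschitz h ->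
  exists L eps, [/\ 0 <= L, 0 < eps & forall v w, `|v - x| <= eps ->
    `|w - x| <= eps -> `|h v - h w| <= L * `|v - w|].
Proof.
move=> /(_ x)[U /nbhs_ballP[e /= e0 eU] /pinfty_ex_gt0[L L0 hL]].
exists L, (e / 2); split; [exact: ltW | exact: divr_gt0 |] => v w vx wx.
apply: (hL (v, w)); split; apply: eU; rewrite -ball_normE /= distrC; lra.
Qed.

Lemma locally_lipschitz_continuous V W (h : V -> W) :
  locally_lipschitz h -> continuous h.
Proof.
move=> /locally_lipschitz_ball hL x.
have [L [e [L0 e0 hLe]]] := hL x.
apply/cvgrPdist_le => d d0.
have d' : 0 < Num.min e (d / (L + 1)).
  by rewrite lt_min e0 divr_gt0 //; lra.
near=> z.
have zx : `|x - z| <= Num.min e (d / (L + 1)).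
  by near: z; exact: cvgr_dist_le.
move: zx; rewrite le_min => /andP[ze zd].
have := hLe x z; rewrite subrr normr0 [`|z - x|]distrC => /(_ (ltW e0) ze) h1.
rewrite ler_pdivlMr in zd; last by lra.
have : 0 <= `|x - z| by [].
by rewrite mulrDr mulrC in zd; lra.
Unshelve. all: by end_near. Qed.

(** Local constants hold on short time intervals; adjacent intervals share the larger Lipschitz
    constant and the smaller radius, so that [cousin] yields uniform ones. *)
Lemma lipschitz_tube T V W (u : R -> V) (f : V -> W) : 0 <= T ->
  absolutely_continuous_on 0 T u -> locally_lipschitz f ->
  exists L eps, [/\ 0 <= L, 0 < eps & forall t v w, 0 <= t -> t <= T ->
    `|v - u t| <= eps -> `|w - u t| <= eps -> `|f v - f w| <= L * `|v - w|].
Proof.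
move=> T0 acu f_lip.
apply: (@cousin _ T (fun a b => exists L eps, [/\ 0 <= L, 0 < eps &
  forall t v w, a <= t -> t <= b ->
  `|v - u t| <= eps -> `|w - u t| <= eps -> `|f v - f w| <= L * `|v - w|])) => //.
  move=> a b c _ ab bc _ [L [e [L0 e0 H]]] [L' [e' [L'0 e'0 H']]].
  exists (Num.max L L'), (Num.min e e'); split.
  - by rewrite le_max L0.
  - by rewrite lt_min e0.
  - move=> t v w at_ tc; rewrite !le_min => /andP[ve ve'] /andP[we we'].
    case: (leP t b) => tb.
      apply: (le_trans (H _ _ _ at_ tb ve we)).
      by rewrite ler_wpM2r // le_max lexx.
    apply: (le_trans (H' _ _ _ (ltW tb) tc ve' we')).
    by rewrite ler_wpM2r // le_max lexx orbT.
move=> t t0 tT.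
have [L [e [L0 e0 H]]] := locally_lipschitz_ball (u t) f_lip.
(* Half of the radius is spent on the motion of [u], half on the distance from [u s]. *)
have e2 : 0 < e / 2 by rewrite divr_gt0.
have [d d0 ud] := absolutely_continuous_on_unif acu e2.
exists d => // a b a0 at_ tb bT ba; exists L, (e / 2); split => //.
move=> s v w as_ sb vs ws.
have us : `|u s - u t| < e / 2.
  by case: (leP s t) => st; [rewrite distrC|]; apply: ud; lra.
have h v' := ler_normD (v' - u s) (u s - u t).
by apply: H; [have := h v | have := h w]; rewrite subrKA; lra.
Qed.

Lemma dir_quotient_lip V W (f : V -> W) x L eps h v w : 0 < h ->
  (forall v w, `|v - x| <= eps -> `|w - x| <= eps ->
    `|f v - f w| <= L * `|v - w|) ->
  h * `|v| <= eps -> h * `|w| <= eps ->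
  `|dir_quotient f x v h - dir_quotient f x w h| <= L * `|v - w|.
Proof.
move=> h0 fL vh wh.
rewrite /dir_quotient -scalerBr opprB addrA subrK normrZ.
rewrite gtr0_norm ?invr_gt0 // ler_pdivrMl // mulrCA.
have -> : h * `|v - w| = `|(x + h *: v) - (x + h *: w)|.
  by rewrite opprD addrACA subrr add0r -scalerBr normrZ gtr0_norm.
by apply: fL; rewrite addrC addKr normrZ gtr0_norm.
Qed.

(** For small steps the difference quotients are [L]-Lipschitz in the direction, and the bound
    passes to the limit. This makes the sensitivity equation Lipschitz in its unknown. *)
Lemma dir_derive_lip V W (f : V -> W) x L eps v w : 0 < eps ->
  dir_differentiable f ->
  (forall v w, `|v - x| <= eps -> `|w - x| <= eps ->
    `|f v - f w| <= L * `|v - w|) ->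
  `|dir_derive f x v - dir_derive f x w| <= L * `|v - w|.
Proof.
move=> eps0 fdd fL.
have cv : `|dir_quotient f x v h - dir_quotient f x w h| @[h --> 0^'+] -->
    `|dir_derive f x v - dir_derive f x w|.
  by apply: cvg_norm; apply: cvgB; exact: fdd.
rewrite -(cvg_lim _ cv) //; apply: limr_le; first by apply/cvg_ex; eexists; exact: cv.
near=> h.
have h0 : 0 < h by near: h; exact: nbhs_right_gt.
apply: (dir_quotient_lip h0 fL).
  have : h < eps / (`|v| + 1).
    by near: h; apply: nbhs_right_lt; rewrite divr_gt0 // ltr_wpDl.
  have := normr_ge0 v => v0; rewrite ltr_pdivlMr; last by lra.
  rewrite mulrDr; lra.
have : h < eps / (`|w| + 1).
  by near: h; apply: nbhs_right_lt; rewrite divr_gt0 // ltr_wpDl.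
have := normr_ge0 w => w0; rewrite ltr_pdivlMr; last by lra.
rewrite mulrDr; lra.
Unshelve. all: by end_near. Qed.

End lipschitz_neighborhoods.

(** * Uniqueness and stability of solutions *)

Section ode_stability.
Context {R : realType}.
Implicit Types (V : normedModType R) (T L : R).
Local Notation mu := (@lebesgue_measure R).

Lemma absolutely_continuous_on_dist a b V (u v : R -> V) :
  absolutely_continuous_on a b u -> absolutely_continuous_on a b v ->
  absolutely_continuous_on a b (fun t => `|u t - v t|).
Proof.
move=> acu acv; apply: (absolutely_continuous_on_le (C := 1) _ acu acv) => //.
move=> l r _ _ _; rewrite mul1r; apply: le_trans (ler_dist_dist _ _) _.
by rewrite opprD addrACA -opprD; exact: ler_normB.
Qed.

Lemma gronwall_homogeneous T L (w : R -> R) : 0 <= L ->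
  (forall t, 0 <= t -> t <= T -> 0 <= w t) ->
  absolutely_continuous_on 0 T w ->
  {ae mu, forall t, t \in `]0, T[ -> slope_le T w t (L * w t)} ->
  forall t, 0 <= t -> t <= T -> w t <= expR (L * T) * w 0.
Proof.
move=> L0 w0 acw slope t t0 tT.
have ac0 : absolutely_continuous_on 0 T (fun _ => 0 : R).
  apply: (absolutely_continuous_on_le (C := 0) _ acw acw) => // l r _ _ _.
  by rewrite subrr normr0 mul0r.
have := @gronwall R T L w (fun _ => 0) L0 w0 acw ac0 _ t t0 tT.
rewrite /= subrr addr0; apply.
move: slope; apply: filterS; first exact: (ae_filter_ringOfSetsType mu).
move=> s h /h{}h; exists 0; split; rewrite ?addr0 //.
move=> e e0; exists 1 => // a b a0 as_ sb _ _ /=.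
by rewrite !oppr0 addr0 add0r; apply: mulr_ge0; lra.
Qed.

Lemma slope_le_min T (w : R -> R) t c e : 0 <= c ->
  slope_le T w t c -> slope_le T (fun s => Num.min (w s) e) t c.
Proof.
move=> c0 wt d /[dup] d0 /wt[r r0 rP]; exists r => // a b a0 at_ tb bT ba.
have := rP _ _ a0 at_ tb bT ba.
have : 0 <= (c + d) * (b - a) by apply: mulr_ge0; lra.
by case: (leP (w a)); case: (leP (w b)); lra.
Qed.

Lemma ode_unique T n (F : R -> 'rV[R]_n -> 'rV[R]_n) u0 u v L : 0 <= L ->
  (forall t a b, 0 <= t -> t <= T -> `|F t a - F t b| <= L * `|a - b|) ->
  ode_solution T F u0 u -> ode_solution T F u0 v ->
  forall t, 0 <= t -> t <= T -> v t = u t.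
Proof.
move=> L0 FL [acu du u0E] [acv dv v0E] t t0 tT.
have : `|v t - u t| <= expR (L * T) * `|v 0 - u 0|.
  apply: (@gronwall_homogeneous T L (fun t => `|v t - u t|)) => //.
    exact: absolutely_continuous_on_dist.
  move: du dv; apply: filterS2; first exact: (ae_filter_ringOfSetsType mu).
  move=> s hu hv sT; have du := hu sT; have dv := hv sT.
  have := slope_le_norm T (is_deriveB dv du).
  by apply: slope_le_trans; apply: FL; move: sT;
    rewrite in_itv /= => /andP[/ltW ? /ltW].
by rewrite u0E v0E subrr normr0 mulr0 normr_le0 subr_eq0 => /eqP.
Qed.

(* Gronwall's lemma is applied to the minimum of [eps] and the distance
   between both solutions; this minimum is stationary where the solution [z]
   is outside of the tube on which [f] is known to be Lipschitz. *)
Lemma ode_stability T n (f : 'rV[R]_n -> 'rV[R]_n) x z L eps :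
  0 <= T -> 0 <= L -> 0 < eps ->
  (forall t v w, 0 <= t -> t <= T -> `|v - x t| <= eps -> `|w - x t| <= eps ->
    `|f v - f w| <= L * `|v - w|) ->
  ode_solution T (fun _ v => f v) (x 0) x ->
  ode_solution T (fun _ v => f v) (z 0) z ->
  expR (L * T) * `|z 0 - x 0| < eps ->
  forall t, 0 <= t -> t <= T -> `|z t - x t| <= expR (L * T) * `|z 0 - x 0|.
Proof.
move=> T0 L0 e0 fL [acx dx _] [acz dz _] small t t0 tT.
have ac := absolutely_continuous_on_dist acz acx.
suff : Num.min `|z t - x t| eps <= expR (L * T) * Num.min `|z 0 - x 0| eps.
  have : Num.min `|z 0 - x 0| eps <= `|z 0 - x 0| by rewrite ge_min lexx.
  move=> /(ler_wpM2l (expR_ge0 (L * T))) h1 h2.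
  have := le_trans h2 h1; rewrite ge_min => /orP[//|]; lra.
apply: (@gronwall_homogeneous T L (fun t => Num.min `|z t - x t| eps)) => //.
- by move=> s _ _; rewrite le_min normr_ge0 ltW.
- apply: (absolutely_continuous_on_le (C := 1) _ ac ac) => // l r _ _ _.
  have : 0 <= `| `|z r - x r| - `|z l - x l| | by [].
  rewrite mul1r; set A := `|z r - x r|; set B := `|z l - x l|.
  move: (ler_norm (A - B)) (ler_norm (- (A - B))); rewrite normrN => h1 h2 h3.
  by case: (leP A); case: (leP B) => *; rewrite ler_norml; apply/andP; split; lra.
- move: dx dz; apply: filterS2; first exact: (ae_filter_ringOfSetsType mu).
  move=> s hx hz sT; have dx := hx sT; have dz := hz sT.
  have /andP[/ltW s0 /ltW sT'] : 0 < s < T by move: sT; rewrite in_itv.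
  case: (leP `|z s - x s| eps) => near_x.
    apply: slope_le_min; first by rewrite mulr_ge0.
    apply: slope_le_trans (slope_le_norm T (is_deriveB dz dx)).
    by apply: fL s0 sT' near_x _; rewrite subrr normr0 ltW.
  have far : 0 < `|z s - x s| - eps by rewrite subr_gt0.
  have [d d0 dP] := absolutely_continuous_on_unif ac far.
  move=> e' e'0; exists d => // a b a0 as_ sb bT ba /=.
  have ha : eps < `|z a - x a|.
    have : `| `|z s - x s| - `|z a - x a| | < `|z s - x s| - eps.
      by apply: dP => //; lra.
    by have := ler_norm (`|z s - x s| - `|z a - x a|); lra.
  have hb : eps < `|z b - x b|.
    have : `| `|z b - x b| - `|z s - x s| | < `|z s - x s| - eps.
      by apply: dP => //; lra.
    rewrite distrC.
    by have := ler_norm (`|z s - x s| - `|z b - x b|); lra.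
  rewrite (min_r (ltW ha)) (min_r (ltW hb)) subrr.
  apply: mulr_ge0; last lra.
  by have := mulr_ge0 L0 (ltW e0); lra.
Qed.

End ode_stability.

(** * Convergence of difference quotients along curves *)

Section difference_quotient_along_curves.
Context {R : realType}.
Implicit Types (V : normedModType R) (T : R).
Local Notation mu := (@lebesgue_measure R).

Lemma cvg_at_right_gt0 (I : Type) (F : set_system I) {FF : Filter F} (u : I -> R) :
  (\forall i \near F, 0 < u i) ->
  u i @[i --> F] --> 0 -> u i @[i --> F] --> 0^'+.
Proof.
move=> u0 cu P P0.
have cuP : \forall i \near F, 0 < u i -> P (u i) := cu _ P0.
by move: u0 cuP; apply: filterS2 => i ui; apply.
Qed.

(** For [0 <= T], the projection onto [[0, T]]; it extends curves continuously to the line, as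
    nothing is known of them outside this interval. *)
Definition clamp T t : R := Num.max 0 (Num.min t T).

Lemma clamp_ge0 T t : 0 <= clamp T t.
Proof. by rewrite le_max lexx. Qed.

Lemma clamp_le T t : 0 <= T -> clamp T t <= T.
Proof. by move=> T0; rewrite ge_max T0 ge_min lexx orbT. Qed.

Lemma clamp_id T t : 0 <= t -> t <= T -> clamp T t = t.
Proof. by move=> t0 tT; rewrite /clamp min_l // max_r. Qed.

Lemma clamp_lip T s t : 0 <= T -> `|clamp T s - clamp T t| <= `|s - t|.
Proof.
move=> T0; rewrite /clamp.
have := ler_norm (s - t); have := ler_norm (- (s - t)); rewrite normrN.
by case: (leP s); case: (leP t); case: (leP 0 s); case: (leP 0 t);
  case: (leP 0 T) => *; rewrite ler_norml; apply/andP; split; lra.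
Qed.

Lemma continuous_clamp T V (u : R -> V) : 0 <= T ->
  absolutely_continuous_on 0 T u -> continuous (u \o clamp T).
Proof.
move=> T0 acu t; apply/cvgrPdist_lt => e e0.
have [d d0 dP] := absolutely_continuous_on_unif acu e0.
near=> s.
have : `|t - s| < d by near: s; exact: cvgr_dist_lt.
move=> /(le_lt_trans (clamp_lip t s T0)) /=.
case: (leP (clamp T t) (clamp T s)) => ts.
  by rewrite distrC ger0_norm ?subr_ge0 // distrC; apply: dP => //;
    [exact: clamp_ge0 | exact: clamp_le].
rewrite ger0_norm ?subr_ge0 ?ltW //.
by apply: dP; [exact: clamp_ge0 | exact: ltW | exact: clamp_le].
Unshelve. all: by end_near. Qed.

(* [k h] is the distance between difference quotient and directional
   derivative, truncated at [C] so that dominated convergence applies for all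
   [h]; nothing is cut off when [h] is small. *)
Lemma dir_quotient_L1 T V (f : V -> V) (X Y : R -> V) : 0 <= T ->
  locally_lipschitz f -> dir_differentiable f ->
  absolutely_continuous_on 0 T X -> absolutely_continuous_on 0 T Y ->
  exists (k : R -> R -> R) (C : R),
    [/\ forall h, measurable_fun setT (k h),
        forall h t, 0 <= k h t <= C,
        \forall h \near 0^'+, forall t, 0 <= t -> t <= T ->
          k h t = `|dir_quotient f (X t) (Y t) h - dir_derive f (X t) (Y t)| &
        \int[mu]_(t in `[0, T]) k h t @[h --> 0^'+] --> (0 : R)].
Proof.
move=> T0 f_lip f_dd acX acY.
have [L [eps [L0 e0 fL]]] := lipschitz_tube T0 acX f_lip.
have [M YM] := absolutely_continuous_on_bounded T0 acY.
have M0 : 0 <= M by apply: le_trans (YM 0 _ T0).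
pose q h t := dir_quotient f (X (clamp T t)) (Y (clamp T t)) h.
pose q0 t := dir_derive f (X (clamp T t)) (Y (clamp T t)).
(* One [L * M] bounds the difference quotient for small [h], the other the directional
   derivative. *)
pose C := L * M + L * M.
have C0 : 0 <= C by apply: addr_ge0; exact: mulr_ge0.
pose k h t : R := Num.min `|q h t - q0 t| C.
have q_cvg t : q h t @[h --> 0^'+] --> q0 t by exact: f_dd.
have dist_cvg t : `|q h t - q0 t| @[h --> 0^'+] --> (0 : R).
  by have h := cvg_norm (cvgB (q_cvg t) (cvg_cst (q0 t))); rewrite subrr normr0 in h; exact: h.
have q_cont h : continuous (q h).
  have cX := continuous_clamp T0 acX; have cY := continuous_clamp T0 acY.
  have cf := locally_lipschitz_continuous f_lip.
  have cXY : continuous (fun t => X (clamp T t) + h *: Y (clamp T t)).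
    by move=> s; apply: cvgD; [exact: cX | apply: cvgZr; exact: cY].
  move=> s; apply: cvgZr; apply: cvgB.
    exact: continuous_comp (cXY s) (cf _).
  exact: continuous_comp (cX s) (cf _).
have k_meas h : measurable_fun setT (k h).
  apply: measurable_minr; last exact: measurable_cst.
  (* [q0] may be discontinuous, but it is the pointwise limit of the continuous quotients with steps
     [1 / (m + 1)]. *)
  apply: (@measurable_fun_cvg _ _ _ _ (fun m t => `|q h t - q m.+1%:R^-1 t|)).
    move=> m; apply: continuous_measurable_fun => t.
    by apply: cvg_norm; apply: cvgB; exact: q_cont.
  move=> t _; apply: cvg_norm; apply: cvgB; first exact: cvg_cst.
  apply: (cvg_comp _ (fun h => q h t) _ (q_cvg t)).
  apply: cvg_at_right_gt0; first by apply: nearW => m; rewrite invr_gt0.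
  exact: cvg_harmonic.
have k_bnd h t : 0 <= k h t <= C.
  by rewrite le_min normr_ge0 C0 ge_min lexx orbT.
exists k, C; split => //.
- near=> h => t t0 tT.
  have h0 : 0 < h by near: h; exact: nbhs_right_gt.
  have hM : h < eps / (M + 1).
    by near: h; apply: nbhs_right_lt; apply: divr_gt0 => //; lra.
  rewrite /k /q /q0 (clamp_id t0 tT) min_l //.
  have fLt := fun v w => @fL t v w t0 tT.
  have hY : h * `|Y t| <= eps.
    have := ler_wpM2l (ltW h0) (YM _ t0 tT).
    by rewrite ltr_pdivlMr in hM; lra.
  (* Comparison with the direction 0, where quotient and derivative vanish, turns the Lipschitz
     estimates into norm bounds. *)
  have dq0 : dir_quotient f (X t) 0 = fun=> 0.
    by apply/funext => s; rewrite /dir_quotient scaler0 addr0 subrr scaler0.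
  have dd0 : dir_derive f (X t) 0 = 0.
    by rewrite /dir_derive dq0; apply: cvg_lim => //; exact: cvg_cst.
  have h1 : `|dir_quotient f (X t) (Y t) h| <= L * M.
    have := dir_quotient_lip h0 fLt hY (w := 0).
    rewrite normr0 mulr0 dq0 !subr0 => /(_ (ltW e0))/le_trans; apply.
    exact: ler_wpM2l (YM _ t0 tT).
  have h2 : `|dir_derive f (X t) (Y t)| <= L * M.
    have := dir_derive_lip (Y t) 0 e0 f_dd fLt.
    rewrite dd0 !subr0 => /le_trans; apply.
    exact: ler_wpM2l (YM _ t0 tT).
  by apply: le_trans (ler_normB _ _) _; exact: lerD.
(* Dominated convergence concerns sequences, so the right limit is tested on positive sequences
   tending to 0. *)
- apply/cvg_at_rightP => u [u0 cu].
  have cu' : u n @[n --> \oo] --> 0^'+.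
    by apply: cvg_at_right_gt0 => //; exact: nearW.
  apply: fine_cvg.
  have -> : (0 : R)%:E = (\int[mu]_(t in `[0%R, T]) cst 0 t)%E by rewrite integral0.
  apply: (@dominated_cvg _ _ _ _ _ _ _ _ (cst C%:E)) => //=.
  + by move=> n; apply/measurable_EFinP; apply: measurable_funTS; exact: k_meas.
  + move=> t _; apply: cvg_EFin; first exact: nearW.
    have : k h t @[h --> 0^'+] --> (0 : R).
      apply: (@squeeze_cvgr _ _ _ _ (fun=> 0) (fun h => `|q h t - q0 t|)) => //.
        apply: nearW => h; have /andP[-> _] := k_bnd h t.
        by rewrite ge_min lexx.
      exact: cvg_cst.
    by move=> kt; apply: (cvg_comp _ _ cu' kt).
  + apply/integrableP; split => //.
    rewrite integral_cst //= lebesgue_measure_itv /= lte_fin.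
    by case: ifP => _; rewrite ?mule0 ?ltry // -EFinD -EFinM ltry.
  + move=> n t _; rewrite lee_fin; have /andP[h0 h1] := k_bnd (u n) t.
    by rewrite ger0_norm.
Unshelve. all: by end_near. Qed.

End difference_quotient_along_curves.

(** * Directional sensitivity of solutions *)

Section sensitivity.
Context {R : realType}.
Local Notation mu := (@lebesgue_measure R).

(** [z h] stands for the solution at the perturbed parameter [p + h *: d]; it is linked to [y]
    through the initial difference quotients. *)
Lemma ode_sensitivity T n (f : 'rV[R]_n -> 'rV[R]_n) (x y : R -> 'rV[R]_n)
    (z : R -> R -> 'rV[R]_n) : 0 <= T ->
  locally_lipschitz f -> dir_differentiable f ->
  ode_solution T (fun _ v => f v) (x 0) x ->
  (forall h, ode_solution T (fun _ v => f v) (z h 0) (z h)) ->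
  ode_solution T (fun t v => dir_derive f (x t) v) (y 0) y ->
  h^-1 *: (z h 0 - x 0) @[h --> 0^'+] --> y 0 ->
  h^-1 *: (z h T - x T) @[h --> 0^'+] --> y T.
Proof.
move=> T0 f_lip f_dd sx sz sy init.
have [acx dx _] := sx; have [acy dy _] := sy.
have [L [eps [L0 e0 fL]]] := lipschitz_tube T0 acx f_lip.
have [M yM] := absolutely_continuous_on_bounded T0 acy.
have M0 : 0 <= M by apply: le_trans (yM 0 _ T0).
have [k [C [mk kC kE k_cvg]]] := dir_quotient_L1 T0 f_lip f_dd acx acy.
have init_cvg : z h 0 - x 0 @[h --> 0^'+] --> (0 : 'rV[R]_n).
  have id_cvg : (h : R^o) @[h --> 0^'+] --> (0 : R^o).
    by apply: cvg_within_filter; exact: cvg_id.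
  have := cvgZ id_cvg init; rewrite scale0r => zx.
  apply: cvg_trans (zx _); apply: near_eq_cvg; near=> h.
  have h0 : 0 < h by near: h; exact: nbhs_right_gt.
  by rewrite scalerA divff ?gt_eqF // scale1r.
pose w0 h := `|h^-1 *: (z h 0 - x 0) - y 0|.
have w0_cvg : w0 h @[h --> 0^'+] --> (0 : R).
  have h := cvg_norm (cvgB init (cvg_cst (y 0))).
  by rewrite subrr normr0 in h; exact: h.
(* The bound that Gronwall's lemma will give for the error at time [T]. *)
pose B h : R := expR (L * T) * (w0 h + \int[mu]_(t in `[0, T]) k h t).
have B_cvg : B h @[h --> 0^'+] --> (0 : R).
  have h := cvgM (cvg_cst (expR (L * T))) (cvgD w0_cvg k_cvg).
  by rewrite addr0 mulr0 in h; exact: h.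
apply/cvgrPdist_le => e e_gt0; near=> h.
have h0 : 0 < h by near: h; exact: nbhs_right_gt.
have hM : h < eps / (M + 1).
  by near: h; apply: nbhs_right_lt; apply: divr_gt0 => //; lra.
have kEh : forall t, 0 <= t -> t <= T ->
    k h t = `|dir_quotient f (x t) (y t) h - dir_derive f (x t) (y t)|.
  by near: h.
(* With an initial value this close, [ode_stability] keeps [z h] in the Lipschitz tube around
   [x]. *)
have small : expR (L * T) * `|z h 0 - x 0| < eps.
  have : `|0 - (z h 0 - x 0)| < eps / expR (L * T).
    near: h; move/cvgrPdist_lt : init_cvg; apply.
    by rewrite divr_gt0 // expR_gt0.
  by rewrite sub0r normrN ltr_pdivlMr ?expR_gt0 // mulrC.
have Be : B h <= e.
  have : `|0 - B h| <= e by near: h; move/cvgrPdist_le : B_cvg; apply.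
  by rewrite sub0r normrN; apply: le_trans; exact: ler_norm.
apply: le_trans Be; rewrite distrC.
have zx_small t : 0 <= t -> t <= T -> `|z h t - x t| <= eps.
  move=> t0 tT; apply: le_trans (ltW small).
  exact: (@ode_stability R T n f x (z h) L eps).
have [acz dz _] := sz h.
pose w t := `|h^-1 *: (z h t - x t) - y t|.
have acw : absolutely_continuous_on 0 T w.
  apply: absolutely_continuous_on_dist => //.
  apply: (absolutely_continuous_on_le (C := h^-1) _ acz acx).
    by rewrite invr_ge0 ltW.
  move=> l r _ _ _; rewrite -scalerBr normrZ gtr0_norm ?invr_gt0 //.
  apply: ler_wpM2l; first by rewrite invr_ge0 ltW.
  by rewrite opprD addrACA -opprD; exact: ler_normB.
pose E (t : R) : R := \int[mu]_(s in `[0, t]) k h s.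
have acE : absolutely_continuous_on 0 T E.
  exact: primitive_absolutely_continuous (mk h) (kC h).
have slopeE := primitive_slope T (mk h) (kC h).
have := @gronwall R T L w E L0 (fun _ _ _ => normr_ge0 _) acw acE _ T T0 (lexx T).
move=> H; apply: le_trans (H _) _; last first.
  apply: ler_wpM2l; first exact: expR_ge0.
  (* The term [E 0] is dropped by its sign. *)
  rewrite lerD2l gerBl; apply: Rintegral_ge0 => s _.
  by have /andP[] := kC h s.
have dw : {ae mu, forall t, t \in `]0, T[ ->
    is_derive t 1 (fun t => h^-1 *: (z h t - x t) - y t)
      (h^-1 *: (f (z h t) - f (x t)) - dir_derive f (x t) (y t))}.
  move: dx dy dz; apply: filterS3; first exact: (ae_filter_ringOfSetsType mu).
  move=> t hx hy hz tT.
  have := is_deriveB (is_deriveZ h^-1 (is_deriveB (hz tT) (hx tT))) (hy tT).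
  exact.
move: slopeE dw; apply: filterS2; first exact: (ae_filter_ringOfSetsType mu).
move=> t slope_k dw tT; have /andP[/ltW t0 /ltW tT'] : 0 < t < T by move: tT; rewrite in_itv.
exists (k h t); split; [by have /andP[] := kC h t | | exact: slope_k].
apply: slope_le_trans (slope_le_norm T (dw tT)).
set dd := dir_derive _ _ _; pose q := dir_quotient f (x t) (y t) h.
(* Inserting [q] splits the derivative of the error: the first part is at most [L * w t] by the
   Lipschitz bound in the tube, the second has norm [k h t]. *)
rewrite -(subrKA q); apply: le_trans (ler_normD _ _) _.
rewrite (kEh _ t0 tT'); apply: lerD => //.
have -> : h^-1 *: (f (z h t) - f (x t)) - q =
    h^-1 *: (f (z h t) - f (x t + h *: y t)).
  by rewrite /q /dir_quotient -scalerBr opprB addrA subrK.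
have -> : w t = h^-1 * `|z h t - (x t + h *: y t)|.
  rewrite -(gtr0_norm (x := h^-1)) ?invr_gt0 // -normrZ /w opprD addrA [in RHS]scalerBr.
  by rewrite scalerA mulVf ?gt_eqF // scale1r.
rewrite normrZ gtr0_norm ?invr_gt0 // mulrCA; apply: ler_wpM2l.
  by rewrite invr_ge0 ltW.
apply: (fL t) => //; first exact: zx_small.
rewrite addrC addKr normrZ gtr0_norm //.
have := ler_wpM2l (ltW h0) (yM _ t0 tT').
by rewrite ltr_pdivlMr in hM; lra.
Unshelve. all: by end_near. Qed.

End sensitivity.

(** * Lower bounds on Clarke's directional derivative in the plane *)

Section compass_difference.
Context {R : realType}.
Implicit Types (phi : 'rV[R]_2 -> R) (p d : 'rV[R]_2).

(** Moving the base point along [p + t *: q] with the step [t] is one admissible approach in the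
    upper limit, which is therefore at least [m]. *)
Lemma le_clarke_dir_derive phi p d (q : 'rV[R]_2) (m : R) :
  (phi (p + t *: q + t *: d) - phi (p + t *: q)) / t @[t --> 0^'+] --> m ->
  (m%:E <= clarke_dir_derive phi p d)%E.
Proof.
move=> cm; apply: le_ereal_inf_tmp => _ [A [[P Q] /= [pP Q0] PQA] <-].
set S := ereal_sup _.
have t_cvg : (t : R^o) @[t --> 0^'+] --> (0 : R^o).
  by apply: cvg_within_filter; exact: cvg_id.
have q_cvg : p + t *: q @[t --> 0^'+] --> p.
  have h := cvgD (cvg_cst p) (cvgZ t_cvg (cvg_cst q)).
  by rewrite scale0r addr0 in h; exact: h.
have near_S : \forall t \near 0^'+,
    (((phi (p + t *: q + t *: d) - phi (p + t *: q)) / t)%:E <= S)%E.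
  near=> t; apply: ereal_sup_ubound; exists (p + t *: q, t) => //.
  by apply: PQA; split => /=; near: t; [exact: (q_cvg _ pP) | exact: Q0].
by apply: (cvge_to_le _ near_S); apply: cvg_EFin cm; exact: nearW.
Unshelve. all: by end_near. Qed.

(** For [c > 0] the step [t] is replaced with [c * t]; for [c = 0] the quotient is constantly
    zero. *)
Lemma dir_quotientZ phi p d c m : 0 <= c ->
  dir_quotient phi p d t @[t --> 0^'+] --> (m : R) ->
  dir_quotient phi p (c *: d) t @[t --> 0^'+] --> (c * m : R).
Proof.
rewrite le_eqVlt => /predU1P[<- _|c0 cm].
  have -> : dir_quotient phi p (0 *: d) = fun=> 0.
    by apply/funext => t; rewrite /dir_quotient scale0r scaler0 addr0 subrr scaler0.
  by rewrite mul0r; exact: cvg_cst.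
have ct : c * t @[t --> 0^'+] --> 0^'+.
  apply: cvg_at_right_gt0.
    by near=> t; apply: mulr_gt0 => //; near: t; exact: nbhs_right_gt.
  have := cvgM (cvg_cst c) (cvg_within_filter (fun t => 0 < t) (@cvg_id _ (nbhs (0 : R)))).
  by rewrite mulr0 => h; exact: h.
have h := cvgM (cvg_cst c) (cvg_comp _ _ ct cm).
apply: cvg_trans (h _ _); apply: near_eq_cvg; near=> t.
have t0 : 0 < t by near: t; exact: nbhs_right_gt.
rewrite /= /dir_quotient scalerA [t * c]mulrC /GRing.scale /= mulrA invfM mulrA.
by rewrite divff ?mul1r // gt_eqF.
Unshelve. all: by end_near. Qed.

Lemma inner_vec2 a b d :
  inner (2^-1 *: vec2 a b) d = (d ord0 ord0 * a + d ord0 ord_max * b) / 2.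
Proof.
rewrite /inner big_ord_recl big_ord1 !mxE /=.
have -> : lift ord0 ord0 = ord_max :> 'I_2 by apply: val_inj.
lra.
Qed.

(* With [F] the directional derivative of [phi] at [p], the displacement [d]
   leads from [(-d1, 0)] to [(0, d2)] and from [(0, -d2)] to [(d1, 0)], and the
   two increments of [F] add up to twice the inner product of [d] with the
   centre of the compass difference: one of them is at least this product. *)
Lemma compass_difference_clarke phi p (a1 b1 a2 b2 : R) :
  dir_quotient phi p (vec2 1 0) t @[t --> 0^'+] --> a1 ->
  dir_quotient phi p (vec2 (-1) 0) t @[t --> 0^'+] --> b1 ->
  dir_quotient phi p (vec2 0 1) t @[t --> 0^'+] --> a2 ->
  dir_quotient phi p (vec2 0 (-1)) t @[t --> 0^'+] --> b2 ->
  clarke_gradient phi p (2^-1 *: vec2 (a1 - b1) (a2 - b2)).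
Proof.
move=> ca1 cb1 ca2 cb2 d.
have vec2Z (c a b : R) : c *: vec2 a b = vec2 (c * a) (c * b).
  by apply/rowP => i; rewrite !mxE; case: ifP.
have vec2D (a b a' b' : R) : vec2 a b + vec2 a' b' = vec2 (a + a') (b + b').
  by apply/rowP => i; rewrite !mxE; case: ifP.
set d1 := d ord0 ord0; set d2 := d ord0 ord_max.
have dE : d = vec2 d1 d2.
  apply/rowP => i; rewrite mxE; case: ifPn => [/eqP -> //|i0].
  by congr (d _ _); apply: val_inj => /=; case: i i0 => -[|[|]].
(* [A c] and [B c] extend the four given limits by positive homogeneity to all directions [(c, 0)]
   and [(0, c)]. *)
pose A c := if 0 <= c then c * a1 else (- c) * b1.
pose B c := if 0 <= c then c * a2 else (- c) * b2.
have cA c : dir_quotient phi p (vec2 c 0) t @[t --> 0^'+] --> (A c : R).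
  rewrite /A; case: leP => [c0|/ltW c0].
    by have := dir_quotientZ c0 ca1; rewrite vec2Z mulr1 mulr0.
  rewrite -oppr_ge0 in c0.
  by have := dir_quotientZ c0 cb1; rewrite vec2Z mulrN1 opprK mulr0.
have cB c : dir_quotient phi p (vec2 0 c) t @[t --> 0^'+] --> (B c : R).
  rewrite /B; case: leP => [c0|/ltW c0].
    by have := dir_quotientZ c0 ca2; rewrite vec2Z mulr1 mulr0.
  rewrite -oppr_ge0 in c0.
  by have := dir_quotientZ c0 cb2; rewrite vec2Z mulrN1 opprK mulr0.
(* At the base point [p + t *: q], the quotient of [phi] in the direction [d] is the difference of
   its quotients at [p] towards [q'] and towards [q]. *)
have incr (q q' : 'rV[R]_2) (m m' : R) : q + d = q' ->
    dir_quotient phi p q t @[t --> 0^'+] --> m ->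
    dir_quotient phi p q' t @[t --> 0^'+] --> m' ->
    ((m' - m)%:E <= clarke_dir_derive phi p d)%E.
  move=> qq' cm cm'; apply: (@le_clarke_dir_derive _ _ _ q).
  have h := cvgB cm' cm; apply: cvg_trans (h _); apply: near_eq_cvg.
  near=> t; rewrite -addrA -scalerDr qq'.
  rewrite -[LHS]/(dir_quotient phi p q' t - dir_quotient phi p q t).
  by rewrite /dir_quotient -scalerBr opprB addrA subrK mulrC.
have i1 : ((B d2 - A (- d1))%:E <= clarke_dir_derive phi p d)%E.
  by apply: incr (cA _) (cB _); rewrite [X in _ + X]dE vec2D addNr add0r.
have i2 : ((A d1 - B (- d2))%:E <= clarke_dir_derive phi p d)%E.
  by apply: incr (cB _) (cA _); rewrite [X in _ + X]dE vec2D addNr add0r.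
have AE : A d1 - A (- d1) = d1 * (a1 - b1).
  by rewrite /A oppr_ge0; case: (ltgtP 0 d1) => [||<-]; lra.
have BE : B d2 - B (- d2) = d2 * (a2 - b2).
  by rewrite /B oppr_ge0; case: (ltgtP 0 d2) => [||<-]; lra.
rewrite inner_vec2 -/d1 -/d2.
(* By [AE] and [BE] the inner product is the mean of both lower bounds: if it exceeds the first, it
   is below the second. *)
case: (leP ((d1 * (a1 - b1) + d2 * (a2 - b2)) / 2) (B d2 - A (- d1))) => h.
  by apply: le_trans i1; rewrite lee_fin.
by apply: le_trans i2; rewrite lee_fin; lra.
Unshelve. all: by end_near. Qed.

End compass_difference.

(** * Chain rule along curves and conclusion *)

Lemma dir_derive_along (R : realType) (V W : normedModType R) (g : V -> W)
    (c : R -> V) (c0 v : V) :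
  locally_lipschitz g -> dir_differentiable g ->
  h^-1 *: (c h - c0) @[h --> 0^'+] --> v ->
  h^-1 *: (g (c h) - g c0) @[h --> 0^'+] --> dir_derive g c0 v.
Proof.
move=> g_lip g_dd cv.
have [L [eps [L0 e0 gL]]] := locally_lipschitz_ball c0 g_lip.
have dist_cvg : `|h^-1 *: (c h - c0) - v| @[h --> 0^'+] --> (0 : R).
  have h := cvg_norm (cvgB cv (cvg_cst v)).
  by rewrite subrr normr0 in h; exact: h.
(* The curve is compared with its tangent [c0 + h *: v], along which the limit is the directional
   derivative; the Lipschitz bound on [g] controls the gap. *)
suff diff_cvg : h^-1 *: (g (c h) - g c0) - dir_quotient g c0 v h
    @[h --> 0^'+] --> (0 : W).
  have h := cvgD diff_cvg (g_dd c0 v).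
  rewrite add0r in h; apply: cvg_trans (h _); apply: near_eq_cvg.
  by apply: nearW => s /=; rewrite subrK.
apply/cvgrPdist_le => e e_gt0.
(* The bound 1 keeps [c h] in the Lipschitz ball for small [h]; the other one makes the error at
   most [L * e / (L + 1)]. *)
have m0 : 0 < Num.min 1 (e / (L + 1)).
  by rewrite lt_min ltr01 divr_gt0 //; lra.
near=> h.
have h0 : 0 < h by near: h; exact: nbhs_right_gt.
have close : `|h^-1 *: (c h - c0) - v| < Num.min 1 (e / (L + 1)).
  have : `|0 - `|h^-1 *: (c h - c0) - v| | < Num.min 1 (e / (L + 1)).
    by near: h; move/cvgrPdist_lt : dist_cvg; exact.
  by rewrite sub0r normrN normr_id.
have h_small : h < eps / (`|v| + 1).
  by near: h; apply: nbhs_right_lt; rewrite divr_gt0 // ltr_wpDl.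
have v0 : 0 <= `|v| by [].
rewrite ltr_pdivlMr in h_small; last by lra.
move: close; rewrite lt_min => /andP[close1 close2].
have -> : 0 - (h^-1 *: (g (c h) - g c0) - dir_quotient g c0 v h) =
    h^-1 *: (g (c0 + h *: v) - g (c h)).
  by rewrite sub0r opprB /dir_quotient -scalerBr opprB addrA subrK.
have hc : `|c h - c0| <= eps.
  have -> : c h - c0 = h *: (h^-1 *: (c h - c0)).
    by rewrite scalerA divff ?gt_eqF // scale1r.
  rewrite normrZ gtr0_norm //; apply: le_trans (ltW h_small).
  apply: ler_wpM2l; first exact: ltW.
  have := ler_normD (h^-1 *: (c h - c0) - v) v; rewrite subrK; lra.
have hv : `|c0 + h *: v - c0| <= eps.
  rewrite addrC addKr normrZ gtr0_norm //; lra.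
rewrite normrZ gtr0_norm ?invr_gt0 // distrC ler_pdivrMl //.
apply: le_trans (gL _ _ hc hv) _.
have -> : `|c h - (c0 + h *: v)| = h * `|h^-1 *: (c h - c0) - v|.
  rewrite -[X in X * _](gtr0_norm h0) -normrZ scalerBr scalerA.
  by rewrite divff ?gt_eqF // scale1r opprD addrA.
rewrite mulrCA; apply: ler_wpM2l; first exact: ltW.
rewrite ltr_pdivlMr in close2; last by lra.
by have := normr_ge0 (h^-1 *: (c h - c0) - v); lra.
Unshelve. all: by end_near. Qed.

Theorem proposition4p6 (R : realType) (n : nat)
  (f : 'rV[R]_n -> 'rV[R]_n) (x0 : 'rV[R]_2 -> 'rV[R]_n)
  (g : 'rV[R]_2 * 'rV[R]_n -> R)
  (f_lip : locally_lipschitz f) (f_dd : dir_differentiable f)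
  (x0_lip : locally_lipschitz x0) (x0_dd : dir_differentiable x0)
  (g_lip : locally_lipschitz g) (g_dd : dir_differentiable g)
  (tf : R) (tf_gt0 : 0 < tf)
  (x : R -> 'rV[R]_2 -> 'rV[R]_n)
  (x_sol : forall p : 'rV[R]_2,
     unique_ode_solution tf (fun _ v => f v) (x0 p) (fun t => x t p))
  (p : 'rV[R]_2)
  (y : R -> 'rV[R]_2 -> 'rV[R]_n)
  (y_sol : forall d : 'rV[R]_2,
     ode_solution tf (fun t v => dir_derive f (x t p) v) (dir_derive x0 p d)
       (fun t => y t d)) :
  let phi := fun q : 'rV[R]_2 => g (q, x tf q) in
  let psi := fun d : 'rV[R]_2 => dir_derive g (p, x tf p) (d, y tf d) in
  (forall d : 'rV[R]_2,
     unique_ode_solution tf (fun t v => dir_derive f (x t p) v)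
       (dir_derive x0 p d) (fun t => y t d)) /\
  clarke_gradient phi p
    (2^-1 *: vec2 (psi (vec2 1 0) - psi (vec2 (-1) 0))
                  (psi (vec2 0 1) - psi (vec2 0 (-1)))).
Proof.
move=> phi psi; have tf0 := ltW tf_gt0.
have x_init q : x 0 q = x0 q by have [[]] := x_sol q.
have y_init d : y 0 d = dir_derive x0 p d by have [] := y_sol d.
have solx q : ode_solution tf (fun _ v => f v) (x 0 q) (fun t => x t q).
  by rewrite x_init; have [] := x_sol q.
have [acx _ _] := solx p.
have [L [eps [L0 e0 fL]]] := lipschitz_tube tf0 acx f_lip.
have phi_dd d : dir_quotient phi p d t @[t --> 0^'+] --> psi d.
  have soly : ode_solution tf (fun t v => dir_derive f (x t p) v) (y 0 d)
      (fun t => y t d) by rewrite y_init.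
  have init : h^-1 *: (x 0 (p + h *: d) - x 0 p) @[h --> 0^'+] --> y 0 d.
    have := x0_dd p d; rewrite y_init /dir_derive.
    suff -> : dir_quotient x0 p d = fun h => h^-1 *: (x 0 (p + h *: d) - x 0 p) by [].
    by apply/funext => h; rewrite !x_init.
  have cx := ode_sensitivity tf0 f_lip f_dd (solx p)
    (fun h => solx (p + h *: d)) soly init.
  (* The chain rule is applied to the curve that pairs each perturbed parameter with its final
     state. *)
  apply: (dir_derive_along (c := fun h => (p + h *: d, x tf (p + h *: d)))
    g_lip g_dd).
  have cd : h^-1 *: (p + h *: d - p) @[h --> 0^'+] --> d.
    have cc : (fun _ : R => d) h @[h --> 0^'+] --> d by exact: cvg_cst.
    apply: cvg_trans cc; apply: near_eq_cvg; near=> h.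
    have h0 : 0 < h by near: h; exact: nbhs_right_gt.
    by rewrite [p + _]addrC addrK scalerA mulVf ?gt_eqF // scale1r.
  exact: cvg_pair cd cx.
split; last by apply: compass_difference_clarke; exact: phi_dd.
move=> d; split; first exact: y_sol.
move=> v solv t; rewrite in_itv /= => /andP[t0 tT].
(* The tube around the trajectory gives one Lipschitz constant for the directional derivatives of
   [f] at all times. *)
apply: (ode_unique L0 _ (y_sol d) solv t0 tT) => s a b s0 sT.
by apply: (dir_derive_lip _ _ e0 f_dd) => v' w'; exact: fL.
Unshelve. all: by end_near. Qed.
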